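(* Let $\mathcal{D}$ be a braided tensor category and suppose that $\mathcal{C}_1,\mathcal{C}_2$ are braided tensor categories each of which is braided over $\mathcal{D}$. Then $\mathcal{C}_1\boxtimes_{\mathcal{D}}\mathcal{C}_2$ has a canonical braiding coming from the braidings in $\mathcal{C}_1,\mathcal{C}_2$ such that the universal balanced functor $B_{1,2}:\mathcal{C}_1\boxtimes\mathcal{C}_2\to\mathcal{C}_1\boxtimes_{\mathcal{D}}\mathcal{C}_2$ is braided.
   Context: Conventions: $k$ is a fixed field; all categories are abelian, finite and $k$-linear, all functors are additive and $k$-linear. A tensor category is a finite $k$-linear abelian rigid monoidal category with $\mathrm{End}(1)\simeq k$. Module categories are assumed exact ($P\otimes M$ is projective for every projective $P$ in the acting category and every $M$). $\boxtimes$ is the Deligne tensor product of abelian categories. Braided over: for a braided tensor category $\mathcal{C}$ with braiding $c$, the Müger center (centralizer) $\mathcal{C}'$ is the full subcategory of objects $X$ with $c_{Y,X}c_{X,Y}=\mathrm{id}_{X\otimes Y}$ for all $Y\in\mathcal{C}$. For braided tensor categories $\mathcal{C},\mathcal{D}$, one says $\mathcal{C}$ is braided over $\mathcal{D}$ if there is a braided inclusion $\mathcal{D}\hookrightarrow\mathcal{C}'$. Composing with $\mathcal{C}'\hookrightarrow\mathcal{C}\to\mathcal{Z}(\mathcal{C})$ (the last functor given by the braiding) gives a braided inclusion $\mathcal{D}\hookrightarrow\mathcal{Z}(\mathcal{C})$; via it $\mathcal{D}$ is identified with a subcategory of $\mathcal{C}$, and $\mathcal{C}$ is a $\mathcal{D}$-bimodule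 category by left and right tensoring. Relative tensor product: let $\mathcal{M}$ be a right and $\mathcal{N}$ a left $\mathcal{D}$-module category. A $\mathcal{D}$-balanced functor is a functor $F:\mathcal{M}\boxtimes\mathcal{N}\to\mathcal{A}$ ($\mathcal{A}$ abelian) with natural isomorphisms $b_{M,X,N}:F((M\otimes X)\boxtimes N)\simeq F(M\boxtimes(X\otimes N))$ ($X\in\mathcal{D}$) satisfying, up to the module associativity constraints, $b_{M,X\otimes Y,N}=b_{M,X,Y\otimes N}\circ b_{M\otimes X,Y,N}$. The relative tensor product is an abelian category $\mathcal{M}\boxtimes_{\mathcal{D}}\mathcal{N}$ with a right exact $\mathcal{D}$-balanced functor $B_{\mathcal{M},\mathcal{N}}:\mathcal{M}\boxtimes\mathcal{N}\to\mathcal{M}\boxtimes_{\mathcal{D}}\mathcal{N}$ universal for right exact $\mathcal{D}$-balanced functors: each such $F$ factors as $F=\overline{F}B_{\mathcal{M},\mathcal{N}}$ for a unique $\overline{F}$. Write $B_{1,2}=B_{\mathcal{C}_1,\mathcal{C}_2}$. Tensor structure: $\mathcal{C}_1\boxtimes\mathcal{C}_2$ carries the factorwise tensor product and factorwise braiding. $\mathcal{C}_1\boxtimes_{\mathcal{D}}\mathcal{C}_2$ carries the canonical tensor product $\overline{\otimes}$ obtained by descending, via the universal property, the functor $B_{1,2}\circ(\otimes_1\boxtimes\otimes_2):(\mathcal{C}_1\boxtimes\mathcal{C}_2)^{\boxtimes 2}\to\mathcal{C}_1\boxtimes_{\mathcal{D}}\mathcal{C}_2$ (factorwise tensor product followed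 by $B_{1,2}$), which is $\mathcal{D}$-balanced in each of the two factors $\mathcal{C}_1\boxtimes\mathcal{C}_2$ using the half-braidings of objects of $\mathcal{D}$; with this structure $B_{1,2}$ is a tensor functor. *)

(* Defs.v *)
From mathcomp Require Import all_boot all_algebra.

Set Implicit Arguments.
Unset Strict Implicit.
Unset Printing Implicit Defensive.

Import GRing.Theory.
Local Open Scope ring_scope.

Declare Scope lincat_scope.
Delimit Scope lincat_scope with lincat.

Record lincat (k : fieldType) : Type := LinCat {
  ob :> Type;
  hom : ob -> ob -> lmodType k;
  idm : forall X, hom X X;
  comp : forall X Y Z, hom Y Z -> hom X Y -> hom X Z;
  compf1 : forall X Y (f : hom X Y), comp f (idm X) = f;
  comp1f : forall X Y (f : hom X Y), comp (idm Y) f = f;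
  compA : forall W X Y Z (h : hom Y Z) (g : hom X Y) (f : hom W X),
    comp h (comp g f) = comp (comp h g) f;
  comp_linl : forall X Y Z (f : hom X Y),
    linear (fun g : hom Y Z => comp g f);
  comp_linr : forall X Y Z (g : hom Y Z),
    linear (fun f : hom X Y => comp g f)
}.

Arguments idm {k C} X : rename.
Arguments comp {k C X Y Z} g f : rename.

Notation "g \oc f" := (comp g f)
  (at level 50, left associativity) : lincat_scope.
Open Scope lincat_scope.

Record iso (k : fieldType) (C : lincat k) (X Y : C) : Type := Iso {
  fwd :> hom X Y;
  bwd : hom Y X;
  fwdK : bwd \oc fwd = idm X;
  bwdK : fwd \oc bwd = idm Y
}.

Section Abelian.
Variables (k : fieldType) (C : lincat k).
Implicit Types X Y Z : C.

Definition is_iso X Y (f : hom X Y) : Prop := exists i : iso X Y, fwd i = f.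

Definition is_zero X : Prop :=
  (forall Y (f : hom X Y), f = 0) /\ (forall Y (f : hom Y X), f = 0).

Definition mono X Y (f : hom X Y) : Prop :=
  forall Z (g h : hom Z X), f \oc g = f \oc h -> g = h.

Definition epi X Y (f : hom X Y) : Prop :=
  forall Z (g h : hom Y Z), g \oc f = h \oc f -> g = h.

Definition is_kernel X Y (f : hom X Y) K (i : hom K X) : Prop :=
  f \oc i = 0 /\
  forall Z (g : hom Z X), f \oc g = 0 -> exists! h : hom Z K, i \oc h = g.

Definition is_cokernel X Y (f : hom X Y) Q (p : hom Y Q) : Prop :=
  p \oc f = 0 /\
  forall Z (g : hom Y Z), g \oc f = 0 -> exists! h : hom Q Z, h \oc p = g.

Definition is_biproduct X Y S (i1 : hom X S) (i2 : hom Y S)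
    (p1 : hom S X) (p2 : hom S Y) : Prop :=
  [/\ p1 \oc i1 = idm X, p2 \oc i2 = idm Y, p1 \oc i2 = 0, p2 \oc i1 = 0
    & (i1 \oc p1) + (i2 \oc p2) = idm S].

Record abelian : Prop := Abelian {
  ab_zero : exists Z : C, is_zero Z;
  ab_biproduct : forall X Y, exists S i1 i2 p1 p2,
    @is_biproduct X Y S i1 i2 p1 p2;
  ab_kernel : forall X Y (f : hom X Y), exists K (i : hom K X), is_kernel f i;
  ab_cokernel : forall X Y (f : hom X Y), exists Q (p : hom Y Q),
    is_cokernel f p;
  ab_mono : forall K X (i : hom K X), mono i ->
    exists Y (f : hom X Y), is_kernel f i;
  ab_epi : forall Y Q (p : hom Y Q), epi p ->
    exists X (f : hom X Y), is_cokernel f p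
}.

Definition simple X : Prop :=
  ~ is_zero X /\ forall Y (i : hom Y X), mono i -> is_zero Y \/ is_iso i.

Inductive finite_length : C -> Prop :=
| FiniteLength0 X : is_zero X -> finite_length X
| FiniteLengthS X Y S (i : hom Y X) (p : hom X S) :
    finite_length Y -> mono i -> is_cokernel i p -> simple S ->
    finite_length X.

Definition projective P : Prop :=
  forall X Y (p : hom X Y) (f : hom P Y), epi p ->
    exists g : hom P X, p \oc g = f.

Record finite : Prop := Finite {
  fin_hom : forall X Y, exists n (e : 'I_n -> hom X Y),
    forall f, exists a : 'I_n -> k, f = \sum_i a i *: e i;
  fin_length : forall X, finite_length X;
  fin_proj : forall X, exists P (p : hom P X), projective P /\ epi p;
  fin_simple : exists n (S : 'I_n -> C),
    forall X, simple X -> exists i, inhabited (iso X (S i))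
}.

End Abelian.

Record fincat (k : fieldType) : Type := FinCat {
  fin_cat :> lincat k;
  fin_abelian : abelian fin_cat;
  fin_finite : finite fin_cat
}.

Record lfun (k : fieldType) (C A : lincat k) : Type := LFun {
  fob :> C -> A;
  fmap : forall X Y : C, hom X Y -> hom (fob X) (fob Y);
  fmap1 : forall X, fmap (idm X) = idm (fob X);
  fmapM : forall X Y Z (g : hom Y Z) (f : hom X Y),
    fmap (g \oc f) = fmap g \oc fmap f;
  fmap_lin : forall X Y, linear (@fmap X Y)
}.
Arguments fmap {k C A} F {X Y} f : rename.

Record bifun (k : fieldType) (C1 C2 A : lincat k) : Type := BiFun {
  bob :> C1 -> C2 -> A;
  bmap : forall (X X' : C1) (Y Y' : C2),
    hom X X' -> hom Y Y' -> hom (bob X Y) (bob X' Y');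
  bmap1 : forall X Y, bmap (idm X) (idm Y) = idm (bob X Y);
  bmapM : forall X X' X'' Y Y' Y'' (f' : hom X' X'') (f : hom X X')
      (g' : hom Y' Y'') (g : hom Y Y'),
    bmap (f' \oc f) (g' \oc g) = bmap f' g' \oc bmap f g;
  bmap_linl : forall X X' Y Y' (g : hom Y Y'),
    linear (fun f : hom X X' => bmap f g);
  bmap_linr : forall X X' Y Y' (f : hom X X'),
    linear (fun g : hom Y Y' => bmap f g)
}.
Arguments bmap {k C1 C2 A} T {X X' Y Y'} f g : rename.

Section Functors.
Variable k : fieldType.

Definition lcomp (C A A' : lincat k) (G : lfun A A') (F : lfun C A) :
  lfun C A'.
Proof.
refine (@LFun k C A' (fun X => G (F X)) (fun X Y f => fmap G (fmap F f)) _ _ _).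
- by move=> X; rewrite !fmap1.
- by move=> X Y Z g f; rewrite !fmapM.
- by move=> X Y a f g; rewrite !fmap_lin.
Defined.

Definition bcomp (C1 C2 A A' : lincat k) (G : lfun A A') (T : bifun C1 C2 A) :
  bifun C1 C2 A'.
Proof.
refine (@BiFun k C1 C2 A' (fun X Y => G (T X Y))
  (fun X X' Y Y' f g => fmap G (bmap T f g)) _ _ _ _).
- by move=> X Y; rewrite bmap1 fmap1.
- by move=> *; rewrite bmapM fmapM.
- by move=> X X' Y Y' g a f f'; rewrite bmap_linl fmap_lin.
- by move=> X X' Y Y' f a g g'; rewrite bmap_linr fmap_lin.
Defined.

Definition natural (C A : lincat k) (F G : lfun C A)
    (eta : forall X, hom (F X) (G X)) : Prop :=
  forall X Y (f : hom X Y), eta Y \oc fmap F f = fmap G f \oc eta X.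

Definition binatural (C1 C2 A : lincat k) (F G : bifun C1 C2 A)
    (eta : forall X Y, hom (F X Y) (G X Y)) : Prop :=
  forall X X' Y Y' (f : hom X X') (g : hom Y Y'),
    eta X' Y' \oc bmap F f g = bmap G f g \oc eta X Y.

Definition rexact (C A : lincat k) (F : lfun C A) : Prop :=
  forall (X Y Q : C) (f : hom X Y) (p : hom Y Q),
    is_cokernel f p -> is_cokernel (fmap F f) (fmap F p).

Definition lexact (C A : lincat k) (F : lfun C A) : Prop :=
  forall (X Y K : C) (f : hom X Y) (i : hom K X),
    is_kernel f i -> is_kernel (fmap F f) (fmap F i).

Definition exact (C A : lincat k) (F : lfun C A) : Prop :=
  lexact F /\ rexact F.

Definition birexact (C1 C2 A : lincat k) (T : bifun C1 C2 A) : Prop :=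
  (forall (Y : C2) (X X' Q : C1) (f : hom X X') (p : hom X' Q),
     is_cokernel f p ->
     is_cokernel (bmap T f (idm Y)) (bmap T p (idm Y))) /\
  (forall (X : C1) (Y Y' Q : C2) (f : hom Y Y') (p : hom Y' Q),
     is_cokernel f p ->
     is_cokernel (bmap T (idm X) f) (bmap T (idm X) p)).

Definition fully_faithful (C A : lincat k) (F : lfun C A) : Prop :=
  forall X Y : C, bijective (fun f : hom X Y => fmap F f).

End Functors.

Section Isos.
Variable k : fieldType.

Definition iso_id (C : lincat k) (X : C) : iso X X :=
  Iso (compf1 (idm X)) (compf1 (idm X)).

Definition iso_inv (C : lincat k) (X Y : C) (i : iso X Y) : iso Y X :=
  Iso (bwdK i) (fwdK i).

Definition iso_comp (C : lincat k) (X Y Z : C) (j : iso Y Z) (i : iso X Y) :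
  iso X Z.
Proof.
refine (@Iso k C X Z (j \oc i) (bwd i \oc bwd j) _ _).
- by rewrite -compA [bwd j \oc _]compA fwdK comp1f fwdK.
- by rewrite -compA [fwd i \oc _]compA bwdK comp1f bwdK.
Defined.

Definition iso_fmap (C A : lincat k) (F : lfun C A) (X Y : C) (i : iso X Y) :
  iso (F X) (F Y).
Proof.
refine (@Iso k A _ _ (fmap F i) (fmap F (bwd i)) _ _).
- by rewrite -fmapM fwdK fmap1.
- by rewrite -fmapM bwdK fmap1.
Defined.

Definition iso_bmap (C1 C2 A : lincat k) (T : bifun C1 C2 A)
    (X X' : C1) (Y Y' : C2) (i : iso X X') (j : iso Y Y') :
  iso (T X Y) (T X' Y').
Proof.
refine (@Iso k A _ _ (bmap T i j) (bmap T (bwd i) (bwd j)) _ _).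
- by rewrite -bmapM !fwdK bmap1.
- by rewrite -bmapM !bwdK bmap1.
Defined.

Lemma bmapMl (C1 C2 A : lincat k) (T : bifun C1 C2 A) (X X' X'' : C1) (Y : C2)
    (f' : hom X' X'') (f : hom X X') :
  bmap T (f' \oc f) (idm Y) = bmap T f' (idm Y) \oc bmap T f (idm Y).
Proof. by rewrite -bmapM compf1. Qed.

Lemma bmapMr (C1 C2 A : lincat k) (T : bifun C1 C2 A) (X : C1) (Y Y' Y'' : C2)
    (g' : hom Y' Y'') (g : hom Y Y') :
  bmap T (idm X) (g' \oc g) = bmap T (idm X) g' \oc bmap T (idm X) g.
Proof. by rewrite -bmapM compf1. Qed.

Lemma comp_isoI (C : lincat k) (X Y Z : C) (i : iso X Y) (f g : hom Y Z) :
  f \oc i = g \oc i -> f = g.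
Proof.
by move=> E; rewrite -[f]compf1 -[g]compf1 -(bwdK i) !compA E.
Qed.

End Isos.

Record monoidal (k : fieldType) (C : lincat k) : Type := Monoidal {
  tens :> bifun C C C;
  unit_ob : C;
  assoc : forall X Y Z, iso (tens (tens X Y) Z) (tens X (tens Y Z));
  lunit : forall X, iso (tens unit_ob X) X;
  runit : forall X, iso (tens X unit_ob) X;
  assoc_nat : forall X X' Y Y' Z Z'
      (f : hom X X') (g : hom Y Y') (h : hom Z Z'),
    assoc X' Y' Z' \oc bmap tens (bmap tens f g) h =
    bmap tens f (bmap tens g h) \oc assoc X Y Z;
  lunit_nat : forall X X' (f : hom X X'),
    lunit X' \oc bmap tens (idm unit_ob) f = f \oc lunit X;
  runit_nat : forall X X' (f : hom X X'),
    runit X' \oc bmap tens f (idm unit_ob) = f \oc runit X;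
  pentagon : forall W X Y Z,
    assoc W X (tens Y Z) \oc assoc (tens W X) Y Z =
    bmap tens (idm W) (assoc X Y Z) \oc assoc W (tens X Y) Z
      \oc bmap tens (assoc W X Y) (idm Z);
  triangle : forall X Y,
    bmap tens (idm X) (lunit Y) \oc assoc X unit_ob Y =
    bmap tens (runit X) (idm Y)
}.

Record braiding (k : fieldType) (C : lincat k) (M : monoidal C) : Type :=
Braiding {
  braid :> forall X Y, iso (M X Y) (M Y X);
  braid_nat : forall X X' Y Y' (f : hom X X') (g : hom Y Y'),
    braid X' Y' \oc bmap M f g = bmap M g f \oc braid X Y;
  hexagon1 : forall X Y Z,
    assoc M Y Z X \oc braid X (M Y Z) \oc assoc M X Y Z =
    bmap M (idm Y) (braid X Z) \oc assoc M Y X Z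
      \oc bmap M (braid X Y) (idm Z);
  hexagon2 : forall X Y Z,
    bwd (assoc M Z X Y) \oc braid (M X Y) Z \oc bwd (assoc M X Y Z) =
    bmap M (braid X Z) (idm Y) \oc bwd (assoc M X Z Y)
      \oc bmap M (idm X) (braid Y Z)
}.

(* [is_dual M Xd X]: Xd is a left dual of X; equivalently, X is a right dual
   of Xd. *)
Definition is_dual (k : fieldType) (C : lincat k) (M : monoidal C)
    (Xd X : C) : Prop :=
  exists (ev : hom (M Xd X) (unit_ob M)) (coev : hom (unit_ob M) (M X Xd)),
    runit M X \oc bmap M (idm X) ev \oc assoc M X Xd X
      \oc bmap M coev (idm X) \oc bwd (lunit M X) = idm X /\
    lunit M Xd \oc bmap M ev (idm Xd) \oc bwd (assoc M Xd X Xd)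
      \oc bmap M (idm Xd) coev \oc bwd (runit M Xd) = idm Xd.

Definition rigid (k : fieldType) (C : lincat k) (M : monoidal C) : Prop :=
  forall X : C, (exists Y, is_dual M Y X) /\ (exists Y, is_dual M X Y).

Definition unit_end_scalar (k : fieldType) (C : lincat k) (M : monoidal C) :
    Prop :=
  bijective (fun a : k => a *: idm (unit_ob M)).

Record tensor_cat (k : fieldType) : Type := TensorCat {
  tc_cat :> fincat k;
  tc_mon : monoidal tc_cat;
  tc_rigid : rigid tc_mon;
  tc_unit : unit_end_scalar tc_mon
}.

Record braided_cat (k : fieldType) : Type := BraidedCat {
  bc_cat :> tensor_cat k;
  bc_braid : braiding (tc_mon bc_cat)
}.

Record monfun (k : fieldType) (C A : lincat k) (MC : monoidal C)
    (MA : monoidal A) (F : lfun C A) : Type := MonFun {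
  mf_tens :> forall X Y, iso (MA (F X) (F Y)) (F (MC X Y));
  mf_unit : iso (unit_ob MA) (F (unit_ob MC));
  mf_nat : forall X X' Y Y' (f : hom X X') (g : hom Y Y'),
    mf_tens X' Y' \oc bmap MA (fmap F f) (fmap F g) =
    fmap F (bmap MC f g) \oc mf_tens X Y;
  mf_assoc : forall X Y Z,
    fmap F (assoc MC X Y Z) \oc mf_tens (MC X Y) Z
      \oc bmap MA (mf_tens X Y) (idm (F Z)) =
    mf_tens X (MC Y Z) \oc bmap MA (idm (F X)) (mf_tens Y Z)
      \oc assoc MA (F X) (F Y) (F Z);
  mf_lunit : forall X,
    fmap F (lunit MC X) \oc mf_tens (unit_ob MC) X
      \oc bmap MA mf_unit (idm (F X)) = lunit MA (F X);
  mf_runit : forall X,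
    fmap F (runit MC X) \oc mf_tens X (unit_ob MC)
      \oc bmap MA (idm (F X)) mf_unit = runit MA (F X)
}.

Definition braided_functor (k : fieldType) (C A : lincat k) (MC : monoidal C)
    (MA : monoidal A) (F : lfun C A) (J : monfun MC MA F)
    (cC : braiding MC) (cA : braiding MA) : Prop :=
  forall X Y, fmap F (cC X Y) \oc J X Y = J Y X \oc cA (F X) (F Y).

Definition muger_center (k : fieldType) (C : braided_cat k) (X : C) : Prop :=
  forall Y : C, bc_braid C Y X \oc bc_braid C X Y = idm (tc_mon C X Y).

(* A braided inclusion of D into the Mueger center of C. The latter being a
   full subcategory, this is a braided inclusion (fully faithful exact braided
   monoidal functor) into C all of whose values lie in the center. *)
Record braided_over (k : fieldType) (D C : braided_cat k) : Type :=
BraidedOver {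
  bo_fun :> lfun D C;
  bo_mon : monfun (tc_mon D) (tc_mon C) bo_fun;
  bo_exact : exact bo_fun;
  bo_ff : fully_faithful bo_fun;
  bo_braided : braided_functor bo_mon (bc_braid D) (bc_braid C);
  bo_muger : forall X : D, muger_center (bo_fun X)
}.

Record rmodule (k : fieldType) (D : lincat k) (MD : monoidal D)
    (M : lincat k) : Type := RModule {
  ract :> bifun M D M;
  ract_assoc : forall m X Y, iso (ract (ract m X) Y) (ract m (MD X Y));
  ract_unit : forall m, iso (ract m (unit_ob MD)) m;
  ract_assoc_nat : forall m m' X X' Y Y'
      (f : hom m m') (g : hom X X') (h : hom Y Y'),
    ract_assoc m' X' Y' \oc bmap ract (bmap ract f g) h =
    bmap ract f (bmap MD g h) \oc ract_assoc m X Y;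
  ract_unit_nat : forall m m' (f : hom m m'),
    ract_unit m' \oc bmap ract f (idm (unit_ob MD)) = f \oc ract_unit m;
  ract_pentagon : forall m X Y Z,
    ract_assoc m X (MD Y Z) \oc ract_assoc (ract m X) Y Z =
    bmap ract (idm m) (assoc MD X Y Z) \oc ract_assoc m (MD X Y) Z
      \oc bmap ract (ract_assoc m X Y) (idm Z);
  ract_triangle : forall m X,
    bmap ract (idm m) (lunit MD X) \oc ract_assoc m (unit_ob MD) X =
    bmap ract (ract_unit m) (idm X)
}.

Record lmodule (k : fieldType) (D : lincat k) (MD : monoidal D)
    (N : lincat k) : Type := LModule {
  lact :> bifun D N N;
  lact_assoc : forall X Y n, iso (lact (MD X Y) n) (lact X (lact Y n));
  lact_unit : forall n, iso (lact (unit_ob MD) n) n;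
  lact_assoc_nat : forall X X' Y Y' n n'
      (g : hom X X') (h : hom Y Y') (f : hom n n'),
    lact_assoc X' Y' n' \oc bmap lact (bmap MD g h) f =
    bmap lact g (bmap lact h f) \oc lact_assoc X Y n;
  lact_unit_nat : forall n n' (f : hom n n'),
    lact_unit n' \oc bmap lact (idm (unit_ob MD)) f = f \oc lact_unit n;
  lact_pentagon : forall X Y Z n,
    lact_assoc X Y (lact Z n) \oc lact_assoc (MD X Y) Z n =
    bmap lact (idm X) (lact_assoc Y Z n) \oc lact_assoc X (MD Y Z) n
      \oc bmap lact (assoc MD X Y Z) (idm n);
  lact_triangle : forall X n,
    bmap lact (idm X) (lact_unit n) \oc lact_assoc X (unit_ob MD) n =
    bmap lact (runit MD X) (idm n)
}.

Definition exact_rmodule (k : fieldType) (D : lincat k) (MD : monoidal D)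
    (M : lincat k) (A : rmodule MD M) : Prop :=
  forall (m : M) (P : D), projective P -> projective (A m P).

Definition exact_lmodule (k : fieldType) (D : lincat k) (MD : monoidal D)
    (N : lincat k) (A : lmodule MD N) : Prop :=
  forall (P : D) (n : N), projective P -> projective (A P n).

Section Restriction.
Variables (k : fieldType) (D C : lincat k) (MD : monoidal D) (MC : monoidal C).
Variables (F : lfun D C) (J : monfun MD MC F).

Definition ract_bifun : bifun C D C.
Proof.
refine (@BiFun k C D C (fun m X => MC m (F X))
  (fun m m' X X' f g => bmap MC f (fmap F g)) _ _ _ _).
- by move=> X Y; rewrite fmap1 bmap1.
- by move=> *; rewrite fmapM bmapM.
- by move=> X X' Y Y' g a f f'; rewrite bmap_linl.
- by move=> X X' Y Y' f a g g'; rewrite fmap_lin bmap_linr.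
Defined.

Definition lact_bifun : bifun D C C.
Proof.
refine (@BiFun k D C C (fun X n => MC (F X) n)
  (fun X X' n n' g f => bmap MC (fmap F g) f) _ _ _ _).
- by move=> X Y; rewrite fmap1 bmap1.
- by move=> *; rewrite fmapM bmapM.
- by move=> X X' Y Y' f a g g'; rewrite fmap_lin bmap_linl.
- by move=> X X' Y Y' g a f f'; rewrite bmap_linr.
Defined.

Definition regular_rmodule : rmodule MD C.
Proof.
refine (@RModule k D MD C ract_bifun
  (fun m X Y => iso_comp (iso_bmap MC (iso_id m) (J X Y))
                         (assoc MC m (F X) (F Y)))
  (fun m => iso_comp (runit MC m)
              (iso_bmap MC (iso_id m) (iso_inv (mf_unit J)))) _ _ _ _) => /=.
- move=> m m' X X' Y Y' f g h.
  by rewrite -compA assoc_nat !compA -!bmapM mf_nat comp1f compf1.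
- move=> m m' f.
  by rewrite fmap1 -compA -bmapM comp1f compf1 compA -runit_nat -compA
    -bmapM compf1 comp1f.
- move=> m X Y Z.
  rewrite fmap1 bmapMl.
  rewrite -compA [assoc MC m _ _ \oc (_ \oc _)]compA.
  rewrite -(bmap1 MC m (F X)) assoc_nat.
  rewrite !compA -bmapMr -!compA pentagon !compA -!bmapMr.
  congr (_ \oc _).
  rewrite -[in RHS]compA assoc_nat !compA -!bmapMr; congr (_ \oc _).
  by rewrite mf_assoc.
- move=> m X.
  rewrite fmap1 compA -bmapMr bmapMl.
  apply: (@comp_isoI _ _ _ _ _
    (iso_bmap MC (iso_bmap MC (iso_id m) (mf_unit J)) (iso_id (F X)))).
  rewrite /= -!compA -!bmapMl -bmapMr fwdK bmap1 compf1 assoc_nat.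
  by rewrite compA -bmapMr mf_lunit triangle.
Defined.

Definition regular_lmodule : lmodule MD C.
Proof.
refine (@LModule k D MD C lact_bifun
  (fun X Y n => iso_comp (assoc MC (F X) (F Y) n)
                  (iso_bmap MC (iso_inv (J X Y)) (iso_id n)))
  (fun n => iso_comp (lunit MC n)
              (iso_bmap MC (iso_inv (mf_unit J)) (iso_id n))) _ _ _ _) => /=.
- move=> X X' Y Y' n n' g h f.
  have E : bwd (J X' Y') \oc fmap F (bmap MD g h) =
           bmap MC (fmap F g) (fmap F h) \oc bwd (J X Y).
    by rewrite -[LHS]compf1 -(bwdK (J X Y)) !compA -[_ \oc J X Y]compA -mf_nat
      !compA fwdK comp1f.
  by rewrite -compA -bmapM E comp1f compA -assoc_nat -compA -bmapM compf1.
- move=> n n' f.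
  by rewrite fmap1 -compA -bmapM comp1f compf1 compA -lunit_nat -compA
    -bmapM compf1 comp1f.
- move=> X Y Z n.
  apply: (@comp_isoI _ _ _ _ _ (iso_bmap MC (iso_comp (J (MD X Y) Z)
    (iso_bmap MC (J X Y) (iso_id (F Z)))) (iso_id n))).
  rewrite fmap1 /=.
  rewrite -!compA -!bmapMl ![fmap F _ \oc _]compA mf_assoc.
  rewrite [bwd (J (MD X Y) Z) \oc _]compA fwdK comp1f.
  rewrite assoc_nat bmap1 [bmap MC (bwd (J X Y)) _ \oc _]compA -bmapMl.
  rewrite fwdK bmap1 comp1f pentagon.
  rewrite bmapMr -!compA; congr (_ \oc _).
  rewrite [bwd (J X (MD Y Z)) \oc _]compA fwdK comp1f bmapMl.
  rewrite [assoc MC _ _ _ \oc (_ \oc _)]compA assoc_nat !compA -bmapMr -bmapMl.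
  by rewrite fwdK !bmap1 comp1f.
- move=> X n.
  rewrite fmap1 compA bmapMr.
  apply: (@comp_isoI _ _ _ _ _
    (iso_comp (iso_bmap MC (J X (unit_ob MD)) (iso_id n))
     (iso_bmap MC (iso_bmap MC (iso_id (F X)) (mf_unit J)) (iso_id n)))).
  rewrite /= compA -[_ \oc bmap MC (J _ _) _]compA -bmapMl fwdK bmap1 compf1.
  rewrite -compA assoc_nat compA -[_ \oc bmap MC (idm _) (bmap MC _ _)]compA.
  rewrite -bmapMr -bmapMl fwdK !bmap1 compf1 triangle.
  by rewrite compA -!bmapMl mf_runit.
Defined.

End Restriction.

Section Deligne.
Variable k : fieldType.

(* Composition with T is an equivalence from right exact functors on P to
   bilinear bifunctors on C1 x C2 that are right exact in each variable:
   essential surjectivity is [dl_factor], full faithfulness is [dl_unique]. *)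
Record is_deligne (C1 C2 P : fincat k) (T : bifun C1 C2 P) : Prop :=
IsDeligne {
  dl_rexact : birexact T;
  dl_factor : forall (A : fincat k) (F : bifun C1 C2 A), birexact F ->
    exists (G : lfun P A) (eta : forall X Y, iso (G (T X Y)) (F X Y)),
      rexact G /\ binatural (F := bcomp G T) (G := F) eta;
  dl_unique : forall (A : fincat k) (G H : lfun P A)
      (eta : forall X Y, hom (G (T X Y)) (H (T X Y))),
    rexact G -> rexact H -> binatural (F := bcomp G T) (G := bcomp H T) eta ->
    exists theta : forall Z, hom (G Z) (H Z),
      [/\ natural theta, forall X Y, theta (T X Y) = eta X Y
        & forall theta' : forall Z, hom (G Z) (H Z),
            natural theta' -> (forall X Y, theta' (T X Y) = eta X Y) ->
            forall Z, theta' Z = theta Z]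
}.

Variables (C1 C2 P : lincat k) (T : bifun C1 C2 P).
Variables (M1 : monoidal C1) (M2 : monoidal C2) (MP : monoidal P).

(* MP is the factorwise tensor product, extended from the objects T X Y by
   right exactness in each variable. *)
Record factorwise : Type := Factorwise {
  fw_rexact : birexact MP;
  fw_tens :> forall X Y X' Y',
    iso (MP (T X Y) (T X' Y')) (T (M1 X X') (M2 Y Y'));
  fw_unit : iso (unit_ob MP) (T (unit_ob M1) (unit_ob M2));
  fw_nat : forall X1 X2 Y1 Y2 X1' X2' Y1' Y2'
      (f : hom X1 X2) (g : hom Y1 Y2) (f' : hom X1' X2') (g' : hom Y1' Y2'),
    fw_tens X2 Y2 X2' Y2' \oc bmap MP (bmap T f g) (bmap T f' g') =
    bmap T (bmap M1 f f') (bmap M2 g g') \oc fw_tens X1 Y1 X1' Y1';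
  fw_assoc : forall X Y X' Y' X'' Y'',
    bmap T (assoc M1 X X' X'') (assoc M2 Y Y' Y'')
      \oc fw_tens (M1 X X') (M2 Y Y') X'' Y''
      \oc bmap MP (fw_tens X Y X' Y') (idm (T X'' Y'')) =
    fw_tens X Y (M1 X' X'') (M2 Y' Y'')
      \oc bmap MP (idm (T X Y)) (fw_tens X' Y' X'' Y'')
      \oc assoc MP (T X Y) (T X' Y') (T X'' Y'');
  fw_lunit : forall X Y,
    bmap T (lunit M1 X) (lunit M2 Y) \oc fw_tens (unit_ob M1) (unit_ob M2) X Y
      \oc bmap MP fw_unit (idm (T X Y)) = lunit MP (T X Y);
  fw_runit : forall X Y,
    bmap T (runit M1 X) (runit M2 Y) \oc fw_tens X Y (unit_ob M1) (unit_ob M2)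
      \oc bmap MP (idm (T X Y)) fw_unit = runit MP (T X Y)
}.

Definition factorwise_braiding (tau : factorwise)
    (c1 : braiding M1) (c2 : braiding M2) (cP : braiding MP) : Prop :=
  forall X Y X' Y',
    tau X' Y' X Y \oc cP (T X Y) (T X' Y') =
    bmap T (c1 X X') (c2 Y Y') \oc tau X Y X' Y'.

End Deligne.

Section Balanced.
Variables (k : fieldType) (D M N P : lincat k) (MD : monoidal D).
Variables (RM : rmodule MD M) (LN : lmodule MD N) (T : bifun M N P).

Record balanced (A : lincat k) (F : lfun P A) : Type := Balanced {
  bal :> forall m X n, iso (F (T (RM m X) n)) (F (T m (LN X n)));
  bal_nat : forall m m' X X' n n'
      (f : hom m m') (x : hom X X') (g : hom n n'),
    bal m' X' n' \oc fmap F (bmap T (bmap RM f x) g) =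
    fmap F (bmap T f (bmap LN x g)) \oc bal m X n;
  bal_pentagon : forall m X Y n,
    fmap F (bmap T (idm m) (lact_assoc LN X Y n)) \oc bal m (MD X Y) n
      \oc fmap F (bmap T (ract_assoc RM m X Y) (idm n)) =
    bal m X (LN Y n) \oc bal (RM m X) Y n
}.

Definition bal_comp (A A' : lincat k) (G : lfun A A') (F : lfun P A)
  (b : balanced F) : balanced (lcomp G F).
Proof.
refine (@Balanced A' (lcomp G F) (fun m X n => iso_fmap G (b m X n)) _ _) => /=.
- by move=> *; rewrite -!fmapM bal_nat.
- by move=> *; rewrite -!fmapM bal_pentagon.
Defined.

Definition balanced_morphism (A : lincat k) (F F' : lfun P A)
    (b : balanced F) (b' : balanced F') (eta : forall Z, hom (F Z) (F' Z)) :
    Prop :=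
  forall m X n,
    eta (T m (LN X n)) \oc b m X n = b' m X n \oc eta (T (RM m X) n).

End Balanced.

(* Composition with (B, b) is an equivalence from right exact functors on E to
   right exact balanced functors on P, the Deligne product of M and N. *)
Record is_reltensor (k : fieldType) (D : lincat k) (M N P : fincat k)
    (MD : monoidal D) (RM : rmodule MD M) (LN : lmodule MD N)
    (T : bifun M N P) (E : fincat k) (B : lfun P E)
    (b : balanced RM LN T B) : Prop :=
IsRelTensor {
  rt_rexact : rexact B;
  rt_factor : forall (A : fincat k) (F : lfun P A) (bF : balanced RM LN T F),
    rexact F ->
    exists (G : lfun E A) (eta : forall Z, iso (G (B Z)) (F Z)),
      [/\ rexact G, natural (F := lcomp G B) (G := F) eta
        & balanced_morphism (bal_comp G b) bF eta];
  rt_unique : forall (A : fincat k) (G H : lfun E A)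
      (eta : forall Z, hom (G (B Z)) (H (B Z))),
    rexact G -> rexact H ->
    natural (F := lcomp G B) (G := lcomp H B) eta ->
    balanced_morphism (bal_comp G b) (bal_comp H b) eta ->
    exists theta : forall Z, hom (G Z) (H Z),
      [/\ natural theta, forall Z, theta (B Z) = eta Z
        & forall theta' : forall Z, hom (G Z) (H Z),
            natural theta' -> (forall Z, theta' (B Z) = eta Z) ->
            forall Z, theta' Z = theta Z]
}.

Section Canonical.
Variables (k : fieldType) (D C1 C2 : braided_cat k).
Variables (I1 : braided_over D C1) (I2 : braided_over D C2).

Notation M1 := (tc_mon C1).
Notation M2 := (tc_mon C2).
Notation c1 := (bc_braid C1).
Notation c2 := (bc_braid C2).

Definition over_rmodule : rmodule (tc_mon D) C1 := regular_rmodule (bo_mon I1).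
Definition over_lmodule : lmodule (tc_mon D) C2 := regular_lmodule (bo_mon I2).

(* The half-braiding of X is c_{X,-}; it agrees with the inverse of c_{-,X}
   because X lies in the Mueger center. *)
Definition pull_right (m m' : C1) (X : D) :
    iso (M1 (M1 m (I1 X)) m') (M1 (M1 m m') (I1 X)) :=
  iso_comp (iso_inv (assoc M1 m m' (I1 X)))
    (iso_comp (iso_bmap M1 (iso_id m) (c1 (I1 X) m'))
      (assoc M1 m (I1 X) m')).

Definition pull_left (X : D) (n n' : C2) :
    iso (M2 (I2 X) (M2 n n')) (M2 n (M2 (I2 X) n')) :=
  iso_comp (assoc M2 n (I2 X) n')
    (iso_comp (iso_bmap M2 (c2 (I2 X) n) (iso_id n'))
      (iso_inv (assoc M2 (I2 X) n n'))).

Variables (P E : lincat k) (T : bifun C1 C2 P) (B : lfun P E).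
Variable b : balanced over_rmodule over_lmodule T B.

(* The balancings, in the first and in the second factor P, of the functor
   (T m n, T m' n') |-> B (T (m m') (n n')). *)
Definition balancing1 (m : C1) (X : D) (n : C2) (m' : C1) (n' : C2) :
    iso (B (T (M1 (M1 m (I1 X)) m') (M2 n n')))
        (B (T (M1 m m') (M2 (M2 (I2 X) n) n'))) :=
  iso_comp
    (iso_fmap B
      (iso_bmap T (iso_id (M1 m m')) (iso_inv (assoc M2 (I2 X) n n'))))
    (iso_comp (b (M1 m m') X (M2 n n'))
      (iso_fmap B (iso_bmap T (pull_right m m' X) (iso_id (M2 n n'))))).

Definition balancing2 (m : C1) (n : C2) (m' : C1) (X : D) (n' : C2) :
    iso (B (T (M1 m (M1 m' (I1 X))) (M2 n n')))
        (B (T (M1 m m') (M2 n (M2 (I2 X) n')))) :=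
  iso_comp
    (iso_fmap B (iso_bmap T (iso_id (M1 m m')) (pull_left X n n')))
    (iso_comp (b (M1 m m') X (M2 n n'))
      (iso_fmap B
        (iso_bmap T (iso_inv (assoc M1 m m' (I1 X))) (iso_id (M2 n n'))))).

Variables (MP : monoidal P) (tau : factorwise T M1 M2 MP).
Variables (ME : monoidal E) (J : monfun MP ME B).

Definition comparison (m : C1) (n : C2) (m' : C1) (n' : C2) :
    iso (ME (B (T m n)) (B (T m' n'))) (B (T (M1 m m') (M2 n n'))) :=
  iso_comp (iso_fmap B (tau m n m' n')) (J (T m n) (T m' n')).

(* ME is obtained by descending the functor of [balancing1] and [balancing2]
   along B in both factors: it is right exact in each variable, and the
   comparison isomorphism is balanced in each factor. *)
Record descended : Prop := Descended {
  ds_rexact : birexact ME;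
  ds_bal1 : forall (m : C1) (X : D) (n : C2) (m' : C1) (n' : C2),
    comparison m (M2 (I2 X) n) m' n'
      \oc bmap ME (b m X n) (idm (B (T m' n'))) =
    balancing1 m X n m' n' \oc comparison (M1 m (I1 X)) n m' n';
  ds_bal2 : forall (m : C1) (n : C2) (m' : C1) (X : D) (n' : C2),
    comparison m n m' (M2 (I2 X) n')
      \oc bmap ME (idm (B (T m n))) (b m' X n') =
    balancing2 m n m' X n' \oc comparison m n (M1 m' (I1 X)) n'
}.

End Canonical.

(* Main.v *)
From Stdlib Require Import IndefiniteDescription.
From mathcomp Require Import all_boot all_algebra.
Require Import Defs.

(** By the universal properties of the Deligne and relative tensor products,
    applied in one variable at a time, a natural transformation between
    functors that are right exact in each variable on E is determined by its
    values on the image of B, and a natural family on the image of B extends as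
    soon as it is compatible with the balancing [b] in each variable.  The
    family J^-1 (B cP) J is compatible with [b]: it suffices to check this on
    the objects T m n, where it reduces to one hexagon in C1 and one in C2.
    Its inverse is then compatible as well and extends to the inverse.  The
    first hexagon holds on the image of B, hence everywhere; the second one is
    the first one for the inverse. *)

Set Implicit Arguments.
Unset Strict Implicit.
Unset Printing Implicit Defensive.

(** * Cancellation of isomorphisms in composites *)

Section Composition.
Variables (k : fieldType) (C : lincat k).
Implicit Types X Y Z : C.

Lemma isoK X Y Z (i : iso X Y) (f : hom Z X) : bwd i \oc (fwd i \oc f) = f.
Proof. by rewrite compA fwdK comp1f. Qed.

Lemma isoVK X Y Z (i : iso X Y) (f : hom Z Y) : fwd i \oc (bwd i \oc f) = f.
Proof. by rewrite compA bwdK comp1f. Qed.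

Lemma isorK X Y Z (i : iso X Y) (f : hom Y Z) : f \oc fwd i \oc bwd i = f.
Proof. by rewrite -compA bwdK compf1. Qed.

Lemma isorVK X Y Z (i : iso X Y) (f : hom X Z) : f \oc bwd i \oc fwd i = f.
Proof. by rewrite -compA fwdK compf1. Qed.

Lemma iso_compI X Y Z (i : iso Y Z) (f g : hom X Y) :
  fwd i \oc f = fwd i \oc g -> f = g.
Proof. by move=> e; rewrite -[f](isoK i) e isoK. Qed.

End Composition.

(** * Bifunctors with one variable fixed or with the variables exchanged *)

Section Bifunctors.
Variables (k : fieldType) (C1 C2 A : lincat k).
Implicit Types (T F G : bifun C1 C2 A).

Definition bleft T (Y : C2) : lfun C1 A.
Proof.
refine (@LFun k C1 A (fun X => T X Y) (fun X X' f => bmap T f (idm Y)) _ _ _).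
- by move=> X; rewrite bmap1.
- by move=> X X' X'' g f; rewrite bmapMl.
- by move=> X X' a f g; rewrite bmap_linl.
Defined.

Definition bright T (X : C1) : lfun C2 A.
Proof.
refine (@LFun k C2 A (fun Y => T X Y) (fun Y Y' g => bmap T (idm X) g) _ _ _).
- by move=> Y; rewrite bmap1.
- by move=> Y Y' Y'' g f; rewrite bmapMr.
- by move=> Y Y' a f g; rewrite bmap_linr.
Defined.

(** This makes a braiding on [M] a binatural transformation from [M] to [bswap M]. *)
Definition bswap T : bifun C2 C1 A.
Proof.
refine (@BiFun k C2 C1 A (fun Y X => T X Y) (fun Y Y' X X' g f => bmap T f g)
  _ _ _ _).
- by move=> Y X; rewrite bmap1.
- by move=> *; rewrite bmapM.
- by move=> Y Y' X X' f a g g'; rewrite bmap_linr.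
- by move=> Y Y' X X' g a f f'; rewrite bmap_linl.
Defined.

Lemma birexact_swap T : birexact T -> birexact (bswap T).
Proof. by case. Qed.

Lemma rexact_bleft T Y : birexact T -> rexact (bleft T Y).
Proof. by case=> rT _ X X' Q f p; apply: rT. Qed.

Lemma rexact_bright T X : birexact T -> rexact (bright T X).
Proof. by case=> _ rT Y Y' Q f p; apply: rT. Qed.

Lemma bmap_lr T X X' Y Y' (f : hom X X') (g : hom Y Y') :
  bmap T f (idm Y') \oc bmap T (idm X) g = bmap T f g.
Proof. by rewrite -bmapM comp1f compf1. Qed.

Lemma bmap_rl T X X' Y Y' (f : hom X X') (g : hom Y Y') :
  bmap T (idm X') g \oc bmap T f (idm Y) = bmap T f g.
Proof. by rewrite -bmapM comp1f compf1. Qed.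

Lemma binaturalP F G (eta : forall X Y, hom (F X Y) (G X Y)) :
  (forall Y, natural (F := bleft F Y) (G := bleft G Y) (eta^~ Y)) ->
  (forall X, natural (F := bright F X) (G := bright G X) (eta X)) ->
  binatural eta.
Proof.
move=> nl nr X X' Y Y' f g.
have /= el := nl Y' _ _ f; have /= er := nr X _ _ g.
by rewrite -bmap_lr compA el -compA er compA bmap_lr.
Qed.

Lemma binatural_left F G (eta : forall X Y, hom (F X Y) (G X Y)) Y :
  binatural eta -> natural (F := bleft F Y) (G := bleft G Y) (eta^~ Y).
Proof. by move=> n X X' f; apply: n. Qed.

Lemma binatural_right F G (eta : forall X Y, hom (F X Y) (G X Y)) X :
  binatural eta -> natural (F := bright F X) (G := bright G X) (eta X).
Proof. by move=> n Y Y' f; apply: n. Qed.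

End Bifunctors.

(** * Uniqueness and extension of natural families along [T] and [B] *)

Lemma rexact_comp (k : fieldType) (C A A' : lincat k) (G : lfun A A')
    (F : lfun C A) : rexact G -> rexact F -> rexact (lcomp G F).
Proof. by move=> rG rF X Y Q f p c; apply/rG/rF. Qed.

Lemma deligne_ext (k : fieldType) (C1 C2 P A : fincat k) (T : bifun C1 C2 P)
    (G H : lfun P A) (theta theta' : forall Z, hom (G Z) (H Z)) :
  is_deligne T -> rexact G -> rexact H -> natural theta -> natural theta' ->
  (forall X Y, theta (T X Y) = theta' (T X Y)) ->
  forall Z, theta Z = theta' Z.
Proof.
move=> dT rG rH n n' e Z.
have bn : binatural (F := bcomp G T) (G := bcomp H T)
    (fun X Y => theta (T X Y)).
  by move=> X X' Y Y' f g; apply: n.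
have [th [_ _ u]] := dl_unique dT rG rH bn.
by rewrite (u theta) // (u theta').
Qed.

Section RelativeExtension.
Variables (k : fieldType) (D : lincat k) (M N P E A : fincat k).
Variables (MD : monoidal D) (RM : rmodule MD M) (LN : lmodule MD N).
Variables (T : bifun M N P) (B : lfun P E) (b : balanced RM LN T B).
Hypothesis rtE : is_reltensor b.

(** Naturality of [theta] at the arrow [b m X n] is exactly compatibility with the balancings, so
    both families are the extension that [rt_unique] provides. *)
Lemma reltensor_ext (G H : lfun E A) (theta theta' : forall Z, hom (G Z) (H Z)) :
  rexact G -> rexact H -> natural theta -> natural theta' ->
  (forall Z, theta (B Z) = theta' (B Z)) -> forall Z, theta Z = theta' Z.
Proof.
move=> rG rH n n' e Z.
have nB : natural (F := lcomp G B) (G := lcomp H B) (fun Z => theta (B Z)).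
  by move=> X Y f; apply: n.
have bB : balanced_morphism (bal_comp G b) (bal_comp H b)
    (fun Z => theta (B Z)).
  by move=> m X n0; apply: n.
have [th [_ _ u]] := rt_unique rtE rG rH nB bB.
by rewrite (u theta) // (u theta').
Qed.

Variables G H : bifun E E A.
Hypotheses (rG : birexact G) (rH : birexact H).

Lemma reltensor_ext2 (theta theta' : forall X Y, hom (G X Y) (H X Y)) :
  binatural theta -> binatural theta' ->
  (forall Z W, theta (B Z) (B W) = theta' (B Z) (B W)) ->
  forall X Y, theta X Y = theta' X Y.
Proof.
move=> n n' e X Y.
refine (reltensor_ext (G := bright G X) (H := bright H X)
  (theta := theta X) (theta' := theta' X)
  (rexact_bright X rG) (rexact_bright X rH) _ _ _ Y) => [||W].
- exact: binatural_right.
- exact: binatural_right.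
refine (reltensor_ext (G := bleft G (B W)) (H := bleft H (B W))
  (theta := theta^~ (B W)) (theta' := theta'^~ (B W))
  (rexact_bleft _ rG) (rexact_bleft _ rH) _ _ _ X).
- exact: binatural_left.
- exact: binatural_left.
- by move=> Z; apply: e.
Qed.

(** The family is extended in the first variable for each fixed [W], then in the second for each
    fixed [X]. Uniqueness of extensions carries the compatibilities of [eta] through both stages. *)
Lemma reltensor_factor2 (eta : forall Z W, hom (G (B Z) (B W)) (H (B Z) (B W))) :
  (forall Z Z' W W' (f : hom Z Z') (g : hom W W'),
     eta Z' W' \oc bmap G (fmap B f) (fmap B g) =
     bmap H (fmap B f) (fmap B g) \oc eta Z W) ->
  (forall m X n W,
     eta (T m (LN X n)) W \oc bmap G (b m X n) (idm (B W)) =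
     bmap H (b m X n) (idm (B W)) \oc eta (T (RM m X) n) W) ->
  (forall m X n Z,
     eta Z (T m (LN X n)) \oc bmap G (idm (B Z)) (b m X n) =
     bmap H (idm (B Z)) (b m X n) \oc eta Z (T (RM m X) n)) ->
  exists theta : forall X Y, hom (G X Y) (H X Y),
    binatural theta /\ forall Z W, theta (B Z) (B W) = eta Z W.
Proof.
move=> nat_eta bal1 bal2.
have ex1 W : exists th : forall X, hom (G X (B W)) (H X (B W)),
    natural (F := bleft G (B W)) (G := bleft H (B W)) th /\
    forall Z, th (B Z) = eta Z W.
  have [||th [n e _]] := rt_unique rtE (G := bleft G (B W))
    (H := bleft H (B W)) (eta := eta^~ W) (rexact_bleft (B W) rG)
    (rexact_bleft (B W) rH).
  - by move=> Z Z' f /=; rewrite -(fmap1 B W) nat_eta.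
  - by move=> m X n; apply: bal1.
  - by exists th.
(* One extension is picked for each [W]; uniqueness makes the picks fit together. *)
pose th1 W := sval (constructive_indefinite_description _ (ex1 W)).
have nat_th1 W : natural (F := bleft G (B W)) (G := bleft H (B W)) (th1 W).
  by rewrite /th1; case: constructive_indefinite_description => ? [].
have th1B W Z : th1 W (B Z) = eta Z W.
  by rewrite /th1; case: constructive_indefinite_description => ? [].
(* The arrow [u] will be both [fmap B f], giving naturality of [th1] in its index, and [b m Y n],
   giving compatibility with the balancing. *)
have th1_ext Z0 Z1 (u : hom (B Z0) (B Z1)) : (forall Z,
     eta Z Z1 \oc bmap G (idm (B Z)) u = bmap H (idm (B Z)) u \oc eta Z Z0) ->
   forall X, th1 Z1 X \oc bmap G (idm X) u = bmap H (idm X) u \oc th1 Z0 X.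
  move=> e X; refine (reltensor_ext
    (G := bleft G (B Z0)) (H := bleft H (B Z1))
    (theta := fun X => th1 Z1 X \oc bmap G (idm X) u)
    (theta' := fun X => bmap H (idm X) u \oc th1 Z0 X) _ _ _ _ _ X).
  - exact: rexact_bleft.
  - exact: rexact_bleft.
  - move=> {}X X' f /=; have /= e1 := nat_th1 Z1 _ _ f.
    by rewrite -compA bmap_rl -bmap_lr !compA e1.
  - move=> {}X X' f /=; have /= e1 := nat_th1 Z0 _ _ f.
    by rewrite -compA e1 !compA bmap_rl bmap_lr.
  - by move=> Z /=; rewrite !th1B.
have ex2 X : exists th : forall Y, hom (G X Y) (H X Y),
    natural (F := bright G X) (G := bright H X) th /\
    forall W, th (B W) = th1 W X.
  have [||th [n e _]] := rt_unique rtE (G := bright G X)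
    (H := bright H X) (eta := th1^~ X) (rexact_bright X rG)
    (rexact_bright X rH).
  - by move=> W W' f /=; apply: th1_ext => Z; rewrite -(fmap1 B Z) nat_eta.
  - by move=> m Y n /=; apply: th1_ext => Z.
  - by exists th.
pose th2 X := sval (constructive_indefinite_description _ (ex2 X)).
have nat_th2 X : natural (F := bright G X) (G := bright H X) (th2 X).
  by rewrite /th2; case: constructive_indefinite_description => ? [].
have th2B X W : th2 X (B W) = th1 W X.
  by rewrite /th2; case: constructive_indefinite_description => ? [].
exists th2; split=> [|Z W]; last by rewrite th2B th1B.
apply: binaturalP => // Y X X' f /=.
(* So far [th2] is natural in the first variable only at [Y = B W], where it equals [th1];
   uniqueness in [Y] spreads this to every [Y]. *)
refine (reltensor_ext (G := bright G X) (H := bright H X')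
  (theta := fun Y => th2 X' Y \oc bmap G f (idm Y))
  (theta' := fun Y => bmap H f (idm Y) \oc th2 X Y) _ _ _ _ _ Y) => /=.
- exact: rexact_bright.
- exact: rexact_bright.
- move=> {}Y Y' g /=; have /= e1 := nat_th2 X' _ _ g.
  by rewrite -compA bmap_lr -bmap_rl !compA e1.
- move=> {}Y Y' g /=; have /= e1 := nat_th2 X _ _ g.
  by rewrite -compA e1 !compA bmap_lr bmap_rl.
- by move=> W; rewrite !th2B; apply: nat_th1.
Qed.

End RelativeExtension.

(** * Hexagons with one object from [D] *)

Lemma muger_center_sym (k : fieldType) (C : braided_cat k) (X Y : C) :
  muger_center X -> bc_braid C X Y \oc bc_braid C Y X = idm (tc_mon C Y X).
Proof.
move=> /(_ Y) e; apply: (comp_isoI (i := bc_braid C X Y)).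
by rewrite -compA e compf1 comp1f.
Qed.

Section ModuleHexagons.
Variables (k : fieldType) (D C : braided_cat k) (I : braided_over D C).

Notation M := (tc_mon C).
Notation c := (bc_braid C).

(** Moving first [I X] and then [m] past [m'] is moving their product at once: the second
    hexagon. *)
Lemma braid_pull_right (m m' : C) (X : D) :
  bmap M (c m m') (idm (I X)) \oc pull_right I m m' X =
  bwd (assoc M m' m (I X)) \oc c (M m (I X)) m'.
Proof.
have /= e := hexagon2 c m (I X) m'.
by rewrite /= !compA -e isorVK.
Qed.

Lemma pull_left_braid (X : D) (n n' : C) :
  pull_left I X n' n \oc bmap M (idm (I X)) (c n n') =
  c (M (I X) n) n' \oc bwd (assoc M (I X) n n').
Proof.
have /= e := hexagon2 c (I X) n n'.
by rewrite /= -!compA in e *; rewrite -e isoVK.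
Qed.

(* Only here and in [braid_pull_left] is the Mueger condition needed: the
   half-braiding c_{X,-} has to cancel c_{-,X}. *)
Lemma pull_right_braid (m m' : C) (X : D) :
  pull_right I m m' X \oc c m' (M m (I X)) =
  bmap M (c m' m) (idm (I X)) \oc bwd (assoc M m' m (I X)).
Proof.
apply: (comp_isoI (i := assoc M m' m (I X))).
have /= e := hexagon1 c m' m (I X).
rewrite isorVK /= -!compA; rewrite -!compA in e; rewrite e.
rewrite [bmap M _ (c (I X) m') \oc _]compA -bmapMr.
by rewrite (muger_center_sym _ (bo_muger I X)) bmap1 comp1f isoK.
Qed.

Lemma braid_pull_left (X : D) (n n' : C) :
  c n' (M (I X) n) \oc pull_left I X n' n =
  bwd (assoc M (I X) n n') \oc bmap M (idm (I X)) (c n' n).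
Proof.
apply: (iso_compI (i := assoc M (I X) n n')).
have /= e := hexagon1 c n' (I X) n.
rewrite isoVK /= !compA e -[_ \oc bmap M (c n' (I X)) _ \oc _]compA -bmapMl.
by rewrite (bo_muger I X n') bmap1 compf1 isorK.
Qed.

End ModuleHexagons.

(** * The factorwise braiding exchanges the two balancings *)

Section BraidedBalancing.
Variables (k : fieldType) (D C1 C2 : braided_cat k).
Variables (I1 : braided_over D C1) (I2 : braided_over D C2).
Variables (P E : lincat k) (T : bifun C1 C2 P) (B : lfun P E).
Variable b : balanced (over_rmodule I1) (over_lmodule I2) T B.

Notation M1 := (tc_mon C1).
Notation M2 := (tc_mon C2).
Notation c1 := (bc_braid C1).
Notation c2 := (bc_braid C2).

Lemma balanced_nat (m m' : C1) (X : D) (n n' : C2) (f : hom m m')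
    (g : hom n n') :
  b m' X n' \oc fmap B (bmap T (bmap M1 f (idm (I1 X))) g) =
  fmap B (bmap T f (bmap M2 (idm (I2 X)) g)) \oc b m X n.
Proof.
by have /= := bal_nat b f (idm X) g; rewrite !fmap1.
Qed.

Lemma balancing1E (m : C1) (X : D) (n : C2) (m' : C1) (n' : C2) :
  fwd (balancing1 b m X n m' n') =
  fmap B (bmap T (idm (M1 m m')) (bwd (assoc M2 (I2 X) n n')))
    \oc b (M1 m m') X (M2 n n')
    \oc fmap B (bmap T (pull_right I1 m m' X) (idm (M2 n n'))).
Proof. by rewrite -compA. Qed.

Lemma balancing2E (m : C1) (n : C2) (m' : C1) (X : D) (n' : C2) :
  fwd (balancing2 b m n m' X n') =
  fmap B (bmap T (idm (M1 m m')) (pull_left I2 X n n'))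
    \oc b (M1 m m') X (M2 n n')
    \oc fmap B (bmap T (bwd (assoc M1 m m' (I1 X))) (idm (M2 n n'))).
Proof. by rewrite -compA. Qed.

(** [pull_left_braid] rewrites the [C2] side and [braid_pull_right] the [C1] side; what remains is
    naturality of [b] at the braidings of [m, m'] and of [n, n']. *)
Lemma braid_balancing1 (m : C1) (X : D) (n : C2) (m' : C1) (n' : C2) :
  fmap B (bmap T (c1 m m') (c2 (M2 (I2 X) n) n')) \oc balancing1 b m X n m' n' =
  balancing2 b m' n' m X n
    \oc fmap B (bmap T (c1 (M1 m (I1 X)) m') (c2 n n')).
Proof.
rewrite balancing1E balancing2E !compA -fmapM -bmapM compf1 -pull_left_braid.
rewrite -[fwd (c1 m m')]comp1f bmapM fmapM -!compA; congr (_ \oc _).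
rewrite -fmapM -bmapM -braid_pull_right comp1f compA -balanced_nat -compA.
by rewrite -fmapM -bmapM compf1.
Qed.

(** Here the objects of [D] are crossed from the other side, so the two hexagons are those relying
    on the Mueger condition. *)
Lemma braid_balancing2 (m : C1) (X : D) (n : C2) (m' : C1) (n' : C2) :
  fmap B (bmap T (c1 m' m) (c2 n' (M2 (I2 X) n))) \oc balancing2 b m' n' m X n =
  balancing1 b m X n m' n'
    \oc fmap B (bmap T (c1 m' (M1 m (I1 X))) (c2 n' n)).
Proof.
rewrite balancing1E balancing2E !compA -fmapM -bmapM compf1 braid_pull_left.
rewrite -[fwd (c1 m' m)]comp1f bmapM fmapM -!compA; congr (_ \oc _).
rewrite -fmapM -bmapM pull_right_braid comp1f compA -balanced_nat -compA.
by rewrite -fmapM -bmapM compf1.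
Qed.

End BraidedBalancing.

(** * Transport of the hexagon axioms *)

(** The first hexagon at a single triple, for a family of mere arrows: it can thus be spread from
    the image of [B], and applied to a braiding as well as to its inverse. *)
Definition hexagonal (k : fieldType) (C : lincat k) (M : monoidal C)
    (c : forall X Y, hom (M X Y) (M Y X)) (X Y Z : C) : Prop :=
  assoc M Y Z X \oc c X (M Y Z) \oc assoc M X Y Z =
  bmap M (idm Y) (c X Z) \oc assoc M Y X Z \oc bmap M (c X Y) (idm Z).

Lemma iso_bwd_inj (k : fieldType) (C : lincat k) (X Y : C) (i j : iso X Y) :
  fwd i = fwd j -> bwd i = bwd j.
Proof. by move=> e; apply: (comp_isoI (i := i)); rewrite fwdK e fwdK. Qed.

(** Inverting both sides of the second hexagon gives the first hexagon of the reverse braiding. *)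
Lemma hexagonal_rev (k : fieldType) (C : lincat k) (M : monoidal C)
    (c : braiding M) (X Y Z : C) : hexagonal (fun X Y => bwd (c Y X)) X Y Z.
Proof.
have e := hexagon2 c Y Z X.
have /= := @iso_bwd_inj _ _ _ _
  (iso_comp (iso_comp (iso_inv (assoc M X Y Z)) (c (M Y Z) X))
    (iso_inv (assoc M Y Z X)))
  (iso_comp (iso_comp (iso_bmap M (c Y X) (iso_id Z))
    (iso_inv (assoc M Y X Z))) (iso_bmap M (iso_id Y) (c Z X))) e.
by rewrite /hexagonal !compA.
Qed.

Lemma hexagonal_hexagon2 (k : fieldType) (C : lincat k) (M : monoidal C)
    (c : forall X Y, iso (M X Y) (M Y X)) (X Y Z : C) :
  hexagonal (fun X Y => bwd (c Y X)) Z X Y ->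
  bwd (assoc M Z X Y) \oc c (M X Y) Z \oc bwd (assoc M X Y Z) =
  bmap M (c X Z) (idm Y) \oc bwd (assoc M X Z Y) \oc bmap M (idm X) (c Y Z).
Proof.
rewrite /hexagonal => e.
have /= := @iso_bwd_inj _ _ _ _
  (iso_comp (iso_comp (assoc M X Y Z) (iso_inv (c (M X Y) Z)))
    (assoc M Z X Y))
  (iso_comp (iso_comp (iso_bmap M (iso_id X) (iso_inv (c Y Z)))
    (assoc M X Z Y)) (iso_bmap M (iso_inv (c X Z)) (iso_id Y))) e.
by rewrite !compA.
Qed.

(** After composition with the isomorphism into [B (Y (Z X))] built from [J], both sides become [B]
    of the hexagon of [g], preceded by the structure maps of [B]. *)
Lemma hexagonal_image (k : fieldType) (P E : lincat k) (MP : monoidal P)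
    (ME : monoidal E) (B : lfun P E) (J : monfun MP ME B)
    (g : forall X Y, hom (MP X Y) (MP Y X))
    (t : forall X Y, hom (ME X Y) (ME Y X)) :
  binatural (F := ME) (G := bswap ME) t ->
  (forall X Y, fmap B (g X Y) \oc J X Y = J Y X \oc t (B X) (B Y)) ->
  forall X Y Z, hexagonal g X Y Z -> hexagonal t (B X) (B Y) (B Z).
Proof.
move=> nt e X Y Z h; rewrite /hexagonal.
apply: (iso_compI (i := iso_comp (J Y (MP Z X))
  (iso_bmap ME (iso_id (B Y)) (J Z X)))) => /=.
transitivity (fmap B (assoc MP Y Z X \oc g X (MP Y Z) \oc assoc MP X Y Z)
    \oc J (MP X Y) Z \oc bmap ME (J X Y) (idm (B Z))).
  rewrite !compA -mf_assoc !fmapM -[_ \oc t _ _]compA.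
  (* Naturality of [t] at [J Y Z] replaces [t] at a product of images by [t] at the image of a
     product, where [e] applies. *)
  have /= <- := nt _ _ _ _ (idm (B X)) (J Y Z).
  rewrite !compA -[_ \oc t _ _]compA -e.
  by rewrite -!compA (compA _ _ (assoc ME _ _ _)) -mf_assoc -!compA.
have n1 : fmap B (bmap MP (g X Y) (idm Z)) \oc J (MP X Y) Z =
    J (MP Y X) Z \oc bmap ME (fmap B (g X Y)) (idm (B Z)).
  by rewrite -mf_nat fmap1.
have n2 : J Y (MP Z X) \oc bmap ME (idm (B Y)) (fmap B (g X Z)) =
    fmap B (bmap MP (idm Y) (g X Z)) \oc J Y (MP X Z).
  by rewrite -mf_nat fmap1.
rewrite h !fmapM -!compA (compA _ (J _ Z)) n1 -compA -bmapMl e.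
rewrite (compA _ _ (assoc ME _ _ _ \oc _)) -bmapMr -(e X Z) bmapMr bmapMl.
rewrite !compA n2; congr (_ \oc _); rewrite -!compA; congr (_ \oc _).
by rewrite !compA mf_assoc.
Qed.

(** Both sides are natural in three variables, between functors right exact in each; uniqueness
    replaces [X], [Y], [Z] in turn by images under [B]. *)
Lemma hexagonal_ext (k : fieldType) (D : lincat k) (M N P E : fincat k)
    (MD : monoidal D) (RM : rmodule MD M) (LN : lmodule MD N) (T : bifun M N P)
    (B : lfun P E) (b : balanced RM LN T B) (ME : monoidal E)
    (t : forall X Y, hom (ME X Y) (ME Y X)) :
  is_reltensor b -> birexact ME -> binatural (F := ME) (G := bswap ME) t ->
  (forall X Y Z : P, hexagonal t (B X) (B Y) (B Z)) ->
  forall X Y Z, hexagonal t X Y Z.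
Proof.
move=> rtE rE nt h X Y Z.
pose L X Y Z := assoc ME Y Z X \oc t X (ME Y Z) \oc assoc ME X Y Z.
pose R X Y Z := bmap ME (idm Y) (t X Z) \oc assoc ME Y X Z
  \oc bmap ME (t X Y) (idm Z).
have nL X1 X2 Y1 Y2 Z1 Z2 (f : hom X1 X2) (g : hom Y1 Y2) (e : hom Z1 Z2) :
    L X2 Y2 Z2 \oc bmap ME (bmap ME f g) e =
    bmap ME g (bmap ME e f) \oc L X1 Y1 Z1.
  rewrite /L -!compA assoc_nat (compA (t _ _)).
  have /= -> := nt _ _ _ _ f (bmap ME g e).
  by rewrite !compA assoc_nat.
have nR X1 X2 Y1 Y2 Z1 Z2 (f : hom X1 X2) (g : hom Y1 Y2) (e : hom Z1 Z2) :
    R X2 Y2 Z2 \oc bmap ME (bmap ME f g) e =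
    bmap ME g (bmap ME e f) \oc R X1 Y1 Z1.
  have /= ns := nt _ _ _ _ f g; have /= nr := nt _ _ _ _ f e.
  rewrite /R -!compA -bmapM comp1f ns -[e in LHS]compf1 bmapM.
  rewrite (compA (assoc _ _ _ _)) assoc_nat !compA -bmapM comp1f nr.
  by rewrite -[g in LHS]compf1 bmapM.
change (L X Y Z = R X Y Z).
refine (reltensor_ext rtE (G := lcomp (bleft ME Z) (bleft ME Y))
  (H := lcomp (bright ME Y) (bright ME Z)) (theta := fun X => L X Y Z)
  (theta' := fun X => R X Y Z) _ _ _ _ _ X) => {X} [||X X' f|X X' f|X] /=.
- exact: rexact_comp (rexact_bleft _ rE) (rexact_bleft _ rE).
- exact: rexact_comp (rexact_bright _ rE) (rexact_bright _ rE).
- exact: nL.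
- exact: nR.
refine (reltensor_ext rtE (G := lcomp (bleft ME Z) (bright ME (B X)))
  (H := bleft ME (ME Z (B X))) (theta := fun Y => L (B X) Y Z)
  (theta' := fun Y => R (B X) Y Z) _ _ _ _ _ Y) => {Y} [||Y Y' f|Y Y' f|Y] /=.
- exact: rexact_comp (rexact_bleft _ rE) (rexact_bright _ rE).
- exact: rexact_bleft.
- by rewrite nL bmap1.
- by rewrite nR bmap1.
refine (reltensor_ext rtE (G := bright ME (ME (B X) (B Y)))
  (H := lcomp (bright ME (B Y)) (bleft ME (B X)))
  (theta := fun Z => L (B X) (B Y) Z)
  (theta' := fun Z => R (B X) (B Y) Z) _ _ _ _ _ Z) => {Z} [||Z Z' f|Z Z' f|Z] /=.
- exact: rexact_bright.
- exact: rexact_comp (rexact_bright _ rE) (rexact_bleft _ rE).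
- by rewrite -bmap1 nL.
- by rewrite -bmap1 nR.
exact: h.
Qed.

(** * Compatibility of the braiding on the image of [B] with the balancings *)

Section Descent.
Variables (k : fieldType) (D C1 C2 : braided_cat k).
Variables (I1 : braided_over D C1) (I2 : braided_over D C2).
Variables (P E : fincat k) (T : bifun C1 C2 P) (B : lfun P E).
Variable b : balanced (over_rmodule I1) (over_lmodule I2) T B.
Variables (MP : monoidal P) (tau : factorwise T (tc_mon C1) (tc_mon C2) MP).
Variables (cP : braiding MP) (ME : monoidal E) (J : monfun MP ME B).
Hypotheses (dT : is_deligne T) (rtE : is_reltensor b).
Hypothesis cPfw : factorwise_braiding tau (bc_braid C1) (bc_braid C2) cP.
Hypothesis dsE : descended b tau J.

Notation M1 := (tc_mon C1).
Notation M2 := (tc_mon C2).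
Notation c1 := (bc_braid C1).
Notation c2 := (bc_braid C2).

(* q is J^-1 (B cP) J; it is kept abstract because rewriting with [compA] would
   unfold the composite. *)
Variable q : forall Z W, iso (ME (B Z) (B W)) (ME (B W) (B Z)).
Hypothesis qE : forall Z W, J W Z \oc q Z W = fmap B (cP Z W) \oc J Z W.

Lemma image_braid_nat Z Z' W W' (f : hom Z Z') (g : hom W W') :
  q Z' W' \oc bmap ME (fmap B f) (fmap B g) =
  bmap ME (fmap B g) (fmap B f) \oc q Z W.
Proof.
apply: (iso_compI (i := J W' Z')).
rewrite !compA qE mf_nat -compA mf_nat compA -fmapM braid_nat.
by rewrite fmapM -!compA qE.
Qed.

(** [J] turns [q] into [B cP], and [tau] turns [cP] into the pair [c1], [c2]. *)
Lemma comparison_image_braid m n m' n' :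
  comparison tau J m' n' m n \oc q (T m n) (T m' n') =
  fmap B (bmap T (c1 m m') (c2 n n')) \oc comparison tau J m n m' n'.
Proof.
by rewrite /= -compA qE !compA -!fmapM cPfw.
Qed.

(** Both sides are natural in [W] between right exact functors, so the Deligne property allows
    [W = T m' n']. There [ds_bal1] and [ds_bal2] turn [b] into the two balancings, which
    [braid_balancing1] exchanges. *)
Lemma image_braid_balanced1 m X n W :
  q (T m (over_lmodule I2 X n)) W \oc bmap ME (b m X n) (idm (B W)) =
  bmap ME (idm (B W)) (b m X n) \oc q (T (over_rmodule I1 m X) n) W.
Proof.
have rG Z0 : rexact (lcomp (bright ME Z0) B).
  by apply: rexact_comp (rt_rexact rtE); apply: rexact_bright (ds_rexact dsE).
have rH Z0 : rexact (lcomp (bleft ME Z0) B).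
  by apply: rexact_comp (rt_rexact rtE); apply: rexact_bleft (ds_rexact dsE).
refine (deligne_ext (G := lcomp (bright ME _) B) (H := lcomp (bleft ME _) B)
  (theta := fun W => q _ W \oc bmap ME (b m X n) (idm (B W)))
  (theta' := fun W => bmap ME (idm (B W)) (b m X n) \oc q _ W)
  dT (rG _) (rH _) _ _ _ W) => {W} [W W' f|W W' f|m' n'] /=.
- rewrite -compA bmap_lr -bmap_rl compA -(fmap1 B (T m _)) image_braid_nat.
  by rewrite compA.
- rewrite -compA -(fmap1 B (T (M1 _ _) _)) image_braid_nat !compA fmap1.
  by rewrite bmap_rl bmap_lr.
have q1 := comparison_image_braid m (M2 (I2 X) n) m' n'.
have q2 := comparison_image_braid (M1 m (I1 X)) n m' n'.
have d1 := ds_bal1 dsE m X n m' n'; have d2 := ds_bal2 dsE m' n' m X n.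
have e := braid_balancing1 b m X n m' n'.
(* Only these five equations matter from here on, so the isomorphisms in them are made opaque. *)
move: (comparison tau J) (balancing1 b m X n m' n') (balancing2 b m' n' m X n)
  q1 q2 d1 d2 e => K b1 b2 q1 q2 d1 d2 e.
apply: (iso_compI (i := K m' n' m (M2 (I2 X) n))).
by rewrite !compA q1 d2 -compA d1 -compA q2 !compA e.
Qed.

(** The same reduction in the other variable, ending with [braid_balancing2]. *)
Lemma image_braid_balanced2 m X n W :
  q W (T m (over_lmodule I2 X n)) \oc bmap ME (idm (B W)) (b m X n) =
  bmap ME (b m X n) (idm (B W)) \oc q W (T (over_rmodule I1 m X) n).
Proof.
have rG Z0 : rexact (lcomp (bright ME Z0) B).
  by apply: rexact_comp (rt_rexact rtE); apply: rexact_bright (ds_rexact dsE).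
have rH Z0 : rexact (lcomp (bleft ME Z0) B).
  by apply: rexact_comp (rt_rexact rtE); apply: rexact_bleft (ds_rexact dsE).
refine (deligne_ext (G := lcomp (bleft ME _) B) (H := lcomp (bright ME _) B)
  (theta := fun W => q W _ \oc bmap ME (idm (B W)) (b m X n))
  (theta' := fun W => bmap ME (b m X n) (idm (B W)) \oc q W _)
  dT (rH _) (rG _) _ _ _ W) => {W} [W W' f|W W' f|m' n'] /=.
- rewrite -compA bmap_rl -bmap_lr compA -(fmap1 B (T m _)) image_braid_nat.
  by rewrite compA.
- rewrite -compA -(fmap1 B (T (M1 _ _) _)) image_braid_nat !compA fmap1.
  by rewrite bmap_rl bmap_lr.
have q1 := comparison_image_braid m' n' m (M2 (I2 X) n).
have q2 := comparison_image_braid m' n' (M1 m (I1 X)) n.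
have d1 := ds_bal1 dsE m X n m' n'; have d2 := ds_bal2 dsE m' n' m X n.
have e := braid_balancing2 b m X n m' n'.
move: (comparison tau J) (balancing1 b m X n m' n') (balancing2 b m' n' m X n)
  q1 q2 d1 d2 e => K b1 b2 q1 q2 d1 d2 e.
apply: (iso_compI (i := K m (M2 (I2 X) n) m' n')).
by rewrite !compA q1 d1 -compA d2 -compA q2 !compA e.
Qed.

End Descent.

(** * Existence and uniqueness of the braiding *)

Theorem theorem1p5 (k : fieldType) (D C1 C2 : braided_cat k)
    (I1 : braided_over D C1) (I2 : braided_over D C2)
    (exact1 : exact_rmodule (over_rmodule I1))
    (exact2 : exact_lmodule (over_lmodule I2))
    (* P, T: the Deligne product of C1 and C2, with its factorwise tensor product and braiding *)
    (P : fincat k) (T : bifun C1 C2 P) (deligneP : is_deligne T)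
    (MP : monoidal P) (tau : factorwise T (tc_mon C1) (tc_mon C2) MP)
    (cP : braiding MP)
    (cP_factorwise : factorwise_braiding tau (bc_braid C1) (bc_braid C2) cP)
    (* E, B: the relative tensor product over D, with its canonical tensor product *)
    (E : fincat k) (B : lfun P E)
    (b : balanced (over_rmodule I1) (over_lmodule I2) T B)
    (reltensorE : is_reltensor b)
    (ME : monoidal E) (J : monfun MP ME B)
    (descendedE : descended b tau J) :
  exists c : braiding ME,
    braided_functor J cP c /\
    forall c' : braiding ME, braided_functor J cP c' ->
      forall X Y : E, fwd (c' X Y) = fwd (c X Y).
Proof.
have rE := ds_rexact descendedE; have rE' := birexact_swap rE.
have [q qE] : exists q : forall Z W, iso (ME (B Z) (B W)) (ME (B W) (B Z)),
    forall Z W, J W Z \oc q Z W = fmap B (cP Z W) \oc J Z W.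
  exists (fun Z W =>
    iso_comp (iso_inv (J W Z)) (iso_comp (iso_fmap B (cP Z W)) (J Z W))).
  by move=> Z W; apply: isoVK.
have nq := image_braid_nat qE.
have bq1 := image_braid_balanced1 deligneP reltensorE cP_factorwise descendedE qE.
have bq2 := image_braid_balanced2 deligneP reltensorE cP_factorwise descendedE qE.
have [t [nt tB]] := reltensor_factor2 reltensorE (H := bswap ME) rE rE' nq bq1 bq2.
(* The inverse of [q] has its variables exchanged, so [bq2] yields its compatibility in the first
   variable and [bq1] in the second. *)
have [||| t' [nt' tB']] := reltensor_factor2 reltensorE (H := bswap ME)
    (eta := fun Z W => bwd (q W Z)) rE rE' => /=.
- move=> Z Z' W W' f g; apply: (iso_compI (i := q W' Z')).
  by rewrite isoVK compA nq -compA bwdK compf1.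
- move=> m X n W; apply: (iso_compI (i := q W (T m (over_lmodule I2 X n)))).
  by rewrite isoVK compA bq2 -compA bwdK compf1.
- move=> m X n W; apply: (iso_compI (i := q (T m (over_lmodule I2 X n)) W)).
  by rewrite isoVK compA bq1 -compA bwdK compf1.
(* The composites are natural and equal the identity on the image of [B], hence everywhere. *)
have tK X Y : t' Y X \oc t X Y = idm (ME X Y).
  apply: (reltensor_ext2 reltensorE rE rE
    (theta := fun X Y => t' Y X \oc t X Y)
    (theta' := fun X Y => idm (ME X Y))) => [X1 X2 Y1 Y2 f g|X1 X2 Y1 Y2 f g|Z W].
  - have /= e1 := nt _ _ _ _ f g; have /= e2 := nt' _ _ _ _ g f.
    by rewrite -compA e1 compA e2 compA.
  - by rewrite comp1f compf1.
  - by rewrite tB tB' fwdK.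
have t'K X Y : t Y X \oc t' X Y = idm (ME X Y).
  apply: (reltensor_ext2 reltensorE rE rE
    (theta := fun X Y => t Y X \oc t' X Y)
    (theta' := fun X Y => idm (ME X Y))) => [X1 X2 Y1 Y2 f g|X1 X2 Y1 Y2 f g|Z W].
  - have /= e1 := nt' _ _ _ _ f g; have /= e2 := nt _ _ _ _ g f.
    by rewrite -compA e1 compA e2 compA.
  - by rewrite comp1f compf1.
  - by rewrite tB tB' bwdK.
have hex : forall X Y Z, hexagonal t X Y Z.
  apply: (hexagonal_ext reltensorE rE nt) => X Y Z.
  apply: (hexagonal_image (J := J) nt (g := fun X Y => cP X Y)) => [Z' W|].
  - by rewrite tB qE.
  - exact: hexagon1.
(* [t'] lifts the reverse braiding of [cP], itself hexagonal; inverting this hexagon gives the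
   second one for [t]. *)
have hex' : forall X Y Z, hexagonal t' X Y Z.
  apply: (hexagonal_ext reltensorE rE nt') => X Y Z.
  apply: (hexagonal_image (J := J) nt'
    (g := fun X Y => bwd (cP Y X))) => [Z' W|].
  - have e : fwd (J Z' W) = fmap B (cP W Z') \oc J W Z' \oc bwd (q W Z').
      by rewrite -qE isorK.
    by rewrite tB' e !compA -fmapM fwdK fmap1 comp1f.
  - exact: hexagonal_rev.
pose c0 X Y := Iso (tK X Y) (t'K Y X).
have hex2 X Y Z := @hexagonal_hexagon2 _ _ ME c0 X Y Z (hex' Z X Y).
exists (@Braiding k E ME c0 nt hex hex2); split=> [Z W|c' bc' X Y] /=.
  by rewrite tB qE.
(* If [B] is braided for [c'], then [J] forces [c'] to equal [q] on the image of [B], and naturality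
   forces the rest. *)
apply: (reltensor_ext2 reltensorE rE rE' (theta := fun X Y => fwd (c' X Y))
  (theta' := t)) => [X1 X2 Y1 Y2 f g||Z W] //=.
  exact: braid_nat.
by apply: (iso_compI (i := J W Z)); rewrite tB qE -bc'.
Qed.
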